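(* The diameter of the Cayley graph of the group $G_3$ of the $3$-order two-dimensional magic cube, with respect to the generating set $X=\{V_i^j,\ H_i^j : 1\le i\le 3,\ 1\le j\le 2\}$, equals $8$.
   Context: Let $B_3=\{1,\dots,9\}$ be the set of positions of a $3\times 3$ board, the position in row $x$ and column $y$ having number $\varphi(x,y)=3(x-1)+y$. Permutations act on the right and are composed from left to right. For $1\le i\le 3$ and $j\in\mathbb{Z}$, $$V_i^j=\bigl(\varphi(3,i)\ \varphi(2,i)\ \varphi(1,i)\bigr)^j,\qquad H_i^j=\bigl(\varphi(i,3)\ \varphi(i,2)\ \varphi(i,1)\bigr)^j,$$ i.e. cyclic shifts by $j$ steps of column $i$ (upwards) and of row $i$ (leftwards). $G_3$ is the group of permutations of $B_3$ generated by all these elements. The Cayley graph of a group $G$ with respect to a generating set $X$ has vertex set $G$, and $x,y\in G$ are joined by an edge if and only if $y=gx$ or $x=gy$ for some $g\in X$. The diameter of a connected graph is the maximum distance between two vertices. *)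

(* Defs.v *)
From HB Require Import structures.
From mathcomp Require Import all_boot all_fingroup.

Set Implicit Arguments.
Unset Strict Implicit.
Unset Printing Implicit Defensive.

Local Open Scope group_scope.

(* The permutation written (a_1 a_2 ... a_k) in cycle notation:
   [next s] sends each a_i to a_{i+1}, a_k to a_1, and fixes the rest. *)
Definition cycle_perm (T : finType) (s : seq T) (Us : uniq s) : {perm T} :=
  perm (can_inj (prev_next Us)).

Definition walk (T : finType) (e : rel T) (n : nat) (x y : T) : bool :=
  [exists p : n.-tuple T, path e x p && (last x p == y)].

(* The least length of a walk from x to y. A shortest walk has fewer than
   #|T| edges, so the search is exhaustive; the value is #|T|, larger than any
   distance, exactly when y cannot be reached from x. *)
Definition dist (T : finType) (e : rel T) (x y : T) : nat :=
  find (fun n => walk e n x y) (iota 0 #|T|).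

Definition diameter (T : finType) (e : rel T) : nat :=
  \max_(x : T) \max_(y : T) dist e x y.

Definition cayley (gT : finGroupType) (G : {group gT}) (X : {set gT}) :
    rel (subg_of G) :=
  fun x y => [exists g in X, (val y == g * val x) || (val x == g * val y)].

Arguments cayley {gT} G X.

(* Rows, columns and positions are numbered from 0 instead of 1. Products in
   'S_9 compose from left to right: (s * t) b = t (s b). *)
Definition i1 : 'I_3 := @Ordinal 3 0 isT.
Definition i2 : 'I_3 := @Ordinal 3 1 isT.
Definition i3 : 'I_3 := @Ordinal 3 2 isT.

Fact phi_subproof (x y : 'I_3) : (3 * x + y < 9)%N.
Proof. by case: x => [[|[|[|x]]] ?] //; case: y => [[|[|[|y]]] ?]. Qed.

Definition phi (x y : 'I_3) : 'I_9 := Ordinal (phi_subproof x y).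

Fact V_subproof (i : 'I_3) : uniq [:: phi i3 i; phi i2 i; phi i1 i].
Proof. by case: i => [[|[|[|i]]] ?]. Qed.

Fact H_subproof (i : 'I_3) : uniq [:: phi i i3; phi i i2; phi i i1].
Proof. by case: i => [[|[|[|i]]] ?]. Qed.

Definition V (i : 'I_3) : 'S_9 := cycle_perm (V_subproof i).
Definition H (i : 'I_3) : 'S_9 := cycle_perm (H_subproof i).

(* <[V i]> and <[H i]> are the sets of all integer powers of V i and H i. *)
Definition G3 : {group 'S_9} :=
  <<\bigcup_(i : 'I_3) (<[V i]> :|: <[H i]>)>>%G.

Definition X3 : {set 'S_9} :=
  [set g | [exists i : 'I_3, exists j : 'I_3,
    (1 <= j <= 2)%N && ((g == V i ^+ j) || (g == H i ^+ j))]].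

(* Main.v *)
Require Import Defs.
From mathcomp Require Import all_boot all_fingroup.

Set Implicit Arguments.
Unset Strict Implicit.
Unset Printing Implicit Defensive.

(** The proof is an exhaustive breadth-first search of [G3] from the identity,
    arranged so that the kernel can carry it out.

    A path in the Cayley graph from [x] to [y] multiplies [x] by generators, so
    [y] is within distance [n] of [x] exactly when [y * x^-1] lies in the ball
    [(1 |: X) ^+ n] ([walk_cayleyP]).  Hence the diameter is [n] as soon as the
    sphere of radius [n] is nonempty and the next sphere is empty
    ([diameter_cayley]).  Each sphere comes from the previous one alone:
    multiply it by [X] and remove the ball reached so far ([sphereS]).

    Every generator is a 3-cycle, so all the permutations met are even, and an
    even permutation of nine points is determined by its first seven values.
    Sets of permutations are therefore stored as tries of seven-letter words
    over the nine tiles.  Multiplying a whole set on the right by a move only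
    renames letters, which in a trie means permuting the nine children of every
    node the way a move permutes the nine cells of the board ([mem_relabel],
    [word_line]).  Thus every step of the search is a linear traversal of tries
    instead of a loop over permutations ([codes_layers]).

    The search visits 1, 12, 96, 736, 5208, 28674, 89497, 54741 and 2475
    elements at distances 0 to 8, together the 181440 even permutations, and
    none at distance 9.  The half turn of the board is one of the 2475 elements
    at distance 8. *)

(** * Distances in a Cayley graph *)

Lemma walkP (T : finType) (e : rel T) n x y :
  reflect (exists p, [/\ size p = n, path e x p & last x p = y]) (walk e n x y).
Proof.
apply: (iffP existsP) => [[p /andP[xp /eqP lp]]|[p [sp xp lp]]].
  by exists p; rewrite size_tuple.
by move/eqP: sp => sp; exists (Tuple sp); rewrite /= xp lp eqxx.
Qed.

Lemma dist_le (T : finType) (e : rel T) n x y : walk e n x y -> dist e x y <= n.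
Proof.
move=> wn; have sz := size_iota 0 #|T|; rewrite leqNgt; apply/negP => lt_n.
have lt_nT : n < #|T| by apply: leq_trans lt_n _; rewrite -[leqRHS]sz find_size.
by have := before_find 0 lt_n; rewrite nth_iota ?add0n ?wn.
Qed.

(** Cutting the loops out of a walk leaves fewer than [#|T|] edges, so the
    bounded search in [dist] does find a walk. *)
Lemma walk_dist (T : finType) (e : rel T) n x y :
  walk e n x y -> walk e (dist e x y) x y.
Proof.
case/walkP => p [_ xp]; case: (shortenP xp) => p' xp' up' _ lp'.
have lt_p' : size p' < #|T|.
  by have := max_card [in x :: p']; rewrite (card_uniqP up').
have hw : has (fun n => walk e n x y) (iota 0 #|T|).
  apply/hasP; exists (size p'); first by rewrite mem_iota.
  by apply/walkP; exists p'.
have := nth_find 0 hw.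
have lt_d : dist e x y < #|T| by rewrite has_find size_iota in hw.
by rewrite nth_iota.
Qed.

Section CayleyBalls.

Local Open Scope group_scope.

Variables (gT : finGroupType) (X : {set gT}).
Hypothesis symX : {in X, forall g, g^-1 \in X}.

Definition ball n : {set gT} := (1 |: X) ^+ n.

Lemma ballS n a g : a \in ball n -> g \in 1 |: X -> a * g \in ball n.+1.
Proof. by move=> Ba Xg; rewrite /ball expgSr mem_mulg. Qed.

Lemma subset_ballS n : ball n \subset ball n.+1.
Proof.
by apply/subsetP => a Ba; rewrite -(mulg1 a) ballS // !inE eqxx.
Qed.

Lemma subset_ball m n : m <= n -> ball m \subset ball n.
Proof.
elim: n => [|n IHn]; first by rewrite leqn0 => /eqP->.
rewrite leq_eqVlt ltnS => /predU1P[-> //|/IHn] /subset_trans; apply.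
exact: subset_ballS.
Qed.

Definition sphere n : {set gT} :=
  if n is n'.+1 then ball n :\: ball n' else 1.

(** If [s = a * g] is new at radius [n.+1], then [a] cannot lie in the ball of
    radius [n.-1], for [s] would be in the ball of radius [n]: only the last
    sphere has to be extended. *)
Lemma sphereS n : sphere n.+1 = (sphere n * X) :\: ball n.
Proof.
apply/setP => s; rewrite !inE; case Bs: (s \in ball n) => //=.
apply/idP/mulsgP => [|[a g Sa Xg ->]]; last first.
  apply: ballS; last by rewrite !inE Xg orbT.
  by case: n Sa {Bs} => [|n] //=; rewrite inE => /andP[].
rewrite /ball expgSr => /mulsgP[a g Ba]; rewrite !inE => /predU1P[-> |Xg] Ds.
  by rewrite Ds mulg1 (Ba : a \in ball n) in Bs.
exists a g => //; case: n Ba Bs => [|n] //= Ba Bs.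
rewrite inE Ba andbT; apply/negP => Ba'.
by rewrite Ds ballS ?inE ?Xg ?orbT in Bs.
Qed.

Lemma ball_sphere n : ball n.+1 = ball n :|: sphere n.+1.
Proof.
apply/setP => s; rewrite !inE.
by have [/(subsetP (subset_ballS n)) ->|] := boolP (s \in ball n).
Qed.

Variable G : {group gT}.
Hypothesis genX : <<X>> = G.

Lemma walk_cayleyP n (x y : subg_of G) :
  reflect (exists2 m, m <= n & walk (cayley G X) m x y)
          (val y * (val x)^-1 \in ball n).
Proof.
apply: (iffP idP) => [|[m le_mn /walkP[p [sp xp <-]]]]; last first.
  apply: (subsetP (subset_ball le_mn)); rewrite -{m le_mn}sp.
  elim: p x xp => [|z p IHp] x /=; first by rewrite mulgV set11.
  case/andP=> /exists_inP[g Xg xz] /IHp Bz.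
  rewrite -(mulgKV (val z) (val (last z p))) -mulgA ballS // !inE.
  case/orP: xz => /eqP->; first by rewrite mulgK Xg orbT.
  by rewrite invMg mulKVg symX ?orbT.
elim: n x => [|n IHn] x.
  rewrite /ball expg0 => /set1P; move/(canRL (mulgKV _)); rewrite mul1g => yx.
  exists 0 => //; apply/walkP; exists [::]; split=> //=; exact/esym/val_inj.
rewrite /ball expgSr => /mulsgP[a t Ba]; rewrite !inE => /predU1P[-> |Xt] Dy.
  case: (IHn x) => [|m le_mn wm]; first by rewrite Dy mulg1.
  by exists m; first exact: leqW.
have Gtx : t * val x \in G by rewrite groupM ?(valP x) // -genX mem_gen.
have [|m le_mn /walkP[p [sp zp lp]]] := IHn (subg G (t * val x)).
  by rewrite subgK // invMg mulgA Dy mulgK.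
exists m.+1 => //; apply/walkP; exists (subg G (t * val x) :: p).
split=> //=; first by rewrite sp.
rewrite zp andbT; apply/exists_inP; exists t => //.
by rewrite [val (subg _ _)]subgK // eqxx.
Qed.

Lemma subset_ballG n : ball n \subset G.
Proof.
elim: n => [|n IHn]; first by rewrite /ball expg0 sub1G.
by rewrite /ball expgS mul_subG // subUset sub1G -genX subset_gen.
Qed.

(** An empty sphere makes the balls stationary, and the balls exhaust the
    generated group.  Conversely an element of the sphere of radius [n] is at
    distance [n] from the identity. *)
Lemma diameter_cayley n :
  sphere n != set0 -> sphere n.+1 = set0 -> diameter (cayley G X) = n.
Proof.
case/set0Pn => z Sz stop.
have Bz : z \in ball n by case: n Sz {stop} => [|n] //=; rewrite inE => /andP[].
have stable : ball n.+1 = ball n by rewrite ball_sphere stop setU0.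
have sub_ball m : ball m \subset ball n.
  case: (leqP m n) => [/subset_ball //|/ltnW/subnKC <-].
  elim: (m - n)%N => [|k IHk]; first by rewrite addn0.
  by rewrite addnS -stable /ball !expgSr mulSg.
have sub_G : G \subset ball n by have [m Dm] := gen_expgs X; rewrite -genX Dm.
apply/eqP; rewrite eqn_leq; apply/andP; split.
  apply/bigmax_leqP => x _; apply/bigmax_leqP => y _.
  have [|m le_mn wm] := walk_cayleyP n x y _.
    by apply: (subsetP sub_G); rewrite groupM ?groupV ?(valP x) ?(valP y).
  exact: leq_trans (dist_le wm) le_mn.
pose x := subg G 1; pose y := subg G z.
have Dz : val y * (val x)^-1 = z.
  by rewrite /= !subgK ?group1 ?invg1 ?mulg1 // (subsetP (subset_ballG n)).
apply: leq_trans (leq_bigmax x); apply: leq_trans (leq_bigmax y).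
have [m _ /walk_dist wz] : exists2 m, m <= n & walk (cayley G X) m x y.
  by apply/walk_cayleyP; rewrite Dz.
rewrite leqNgt; apply/negP => lt_dn.
have Bd : z \in ball (dist (cayley G X) x y).
  by rewrite -Dz; apply/walk_cayleyP; exists (dist (cayley G X) x y).
case: n Sz lt_dn {Bz stop stable sub_ball sub_G} => // n /setDP[_ /negP NBz].
by rewrite ltnS => /subset_ball/subsetP/(_ z Bd).
Qed.

End CayleyBalls.

(** * Sets of words on the nine tiles *)

Inductive board (T : Type) := Board of T & T & T & T & T & T & T & T & T.

(** The fallback branch makes [cell] total; only [v < 9] is meaningful. *)
Definition cell T (b : board T) (v : nat) : T :=
  let: Board t0 t1 t2 t3 t4 t5 t6 t7 t8 := b in
  match v with
  | 0 => t0 | 1 => t1 | 2 => t2 | 3 => t3 | 4 => t4 | 5 => t5 | 6 => t6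
  | 7 => t7 | _ => t8
  end.

Definition board_of T (f : nat -> T) : board T :=
  Board (f 0) (f 1) (f 2) (f 3) (f 4) (f 5) (f 6) (f 7) (f 8).

Definition bmap T U (f : T -> U) (b : board T) : board U :=
  let: Board t0 t1 t2 t3 t4 t5 t6 t7 t8 := b in
  Board (f t0) (f t1) (f t2) (f t3) (f t4) (f t5) (f t6) (f t7) (f t8).

Definition bmap2 T U R (f : T -> U -> R) (b : board T) (c : board U) :
    board R :=
  let: Board t0 t1 t2 t3 t4 t5 t6 t7 t8 := b in
  let: Board u0 u1 u2 u3 u4 u5 u6 u7 u8 := c in
  Board (f t0 u0) (f t1 u1) (f t2 u2) (f t3 u3) (f t4 u4) (f t5 u5)
        (f t6 u6) (f t7 u7) (f t8 u8).

Lemma cell_board_of T (f : nat -> T) v : v < 9 -> cell (board_of f) v = f v.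
Proof. by move: v; do 9!case=> //. Qed.

Lemma cell_bmap T U (f : T -> U) b v : cell (bmap f b) v = f (cell b v).
Proof. by case: b => *; move: v; do 9!case=> //. Qed.

Lemma cell_bmap2 T U R (f : T -> U -> R) b c v :
  cell (bmap2 f b c) v = f (cell b v) (cell c v).
Proof. by case: b => *; case: c => *; move: v; do 9!case=> //. Qed.

Inductive line := Col1 | Col2 | Col3 | Row1 | Row2 | Row3.

Definition lines := [:: Col1; Col2; Col3; Row1; Row2; Row3].

Definition cells (l : line) : seq nat :=
  match l with
  | Col1 => [:: 6; 3; 0] | Col2 => [:: 7; 4; 1] | Col3 => [:: 8; 5; 2]
  | Row1 => [:: 2; 1; 0] | Row2 => [:: 5; 4; 3] | Row3 => [:: 8; 7; 6]
  end.

Definition turn (l : line) : nat -> nat := next (cells l).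

(** The moves act on boards with arbitrary contents: the content of cell
    [turn l v] goes to cell [v].  This is the inverse of the move of the tiles,
    because [rot] is used to substitute [turn l] in the letters of words. *)
Definition rot (l : line) T (b : board T) : board T :=
  let: Board a b c d e f g h i := b in
  match l with
  | Col1 => Board g b c a e f d h i
  | Col2 => Board a h c d b f g e i
  | Col3 => Board a b i d e c g h f
  | Row1 => Board c a b d e f g h i
  | Row2 => Board a b c f d e g h i
  | Row3 => Board a b c d e f i g h
  end.

Lemma cell_rot l T (b : board T) v :
  v < 9 -> cell (rot l b) v = cell b (turn l v).
Proof.
move: v => [|[|[|[|[|[|[|[|[|]]]]]]]]] // _.
all: by case: b l => ? ? ? ? ? ? ? ? ? [].
Qed.

Arguments cell : simpl never.
Arguments board_of : simpl never.
Arguments bmap : simpl never.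
Arguments bmap2 : simpl never.
Arguments rot : simpl never.

(** [Leaf] is the set whose only word is the empty one; a [Node] has a child for
    each possible first letter. *)
Inductive trie := Empty | Leaf | Node of board trie.

Fixpoint mem_trie (t : trie) (w : seq nat) : bool :=
  match t, w with
  | Leaf, [::] => true
  | Node b, v :: w' => mem_trie (cell b v) w'
  | _, _ => false
  end.

Fixpoint single (w : seq nat) : trie :=
  if w is v :: w' then
    Node (board_of (fun i => if i == v then single w' else Empty))
  else Leaf.

Fixpoint union (t u : trie) : trie :=
  match t, u with
  | Empty, _ => u
  | Node b, Node c => Node (bmap2 union b c)
  | _, _ => t
  end.

(** Without it, a difference would keep branches that hold no word: the next
    step of the search would traverse them again, and the empty set would not be
    recognized by its constructor. *)
Definition prune (b : board trie) : trie :=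
  if b is Board Empty Empty Empty Empty Empty Empty Empty Empty Empty
  then Empty else Node b.

Fixpoint diff (t u : trie) : trie :=
  match t, u with
  | Node b, Node c => prune (bmap2 diff b c)
  | Leaf, Leaf => Empty
  | _, _ => t
  end.

(** The trie of the words that fall into [t] once [turn l] is applied to each of
    their letters. *)
Fixpoint relabel (l : line) (t : trie) : trie :=
  if t is Node b then Node (rot l (bmap (relabel l) b)) else t.

(** Each line contributes its two moves, [line_perm l] and its square. *)
Definition step (t : trie) : trie :=
  foldr (fun l acc => let u := relabel l t in union u (union (relabel l u) acc))
        Empty lines.

(** The ball of radius [n] and its outermost sphere. *)
Fixpoint layers (n : nat) : trie * trie :=
  if n is n'.+1 then
    let: (b, f) := layers n' in
    let f' := diff (step f) b in (union b f', f')
  else let t := single (iota 0 7) in (t, t).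

Definition tiles (w : seq nat) : bool := all (fun v => v < 9) w.

Lemma turn_lt l v : v < 9 -> turn l v < 9.
Proof. by case: l; move: v; do 9!case=> //. Qed.

(** All words have length [n].  No trie holds both the empty word and longer
    ones, so [union] is only faithful on tries of equal depth. *)
Fixpoint uniform (n : nat) (t : trie) : Prop :=
  match t, n with
  | Empty, _ => True
  | Leaf, 0 => True
  | Node b, n'.+1 => forall v, v < 9 -> uniform n' (cell b v)
  | _, _ => False
  end.

Lemma prune_cases b :
  prune b = Node b \/ prune b = Empty /\ b = board_of (fun=> Empty).
Proof.
case: b => t0 t1 t2 t3 t4 t5 t6 t7 t8; rewrite /board_of.
(* [prune] looks at the children in this order, so a nonempty child settles the
   goal without splitting the later ones. *)
case: t0 => [||?]; try by left.
case: t1 => [||?]; try by left.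
case: t2 => [||?]; try by left.
case: t3 => [||?]; try by left.
case: t4 => [||?]; try by left.
case: t5 => [||?]; try by left.
case: t6 => [||?]; try by left.
case: t7 => [||?]; try by left.
case: t8 => [||?]; try by left.
by right.
Qed.

Lemma uniform_single w : uniform (size w) (single w).
Proof.
elim: w => //= v w IHw i lt_i; rewrite cell_board_of //.
by case: eqP => // _; case: (size w).
Qed.

Lemma mem_single w w' : tiles w' -> mem_trie (single w) w' = (w' == w).
Proof.
elim: w' w => [|v' w' IHw] [|v w] //= /andP[lt_v' w'_tiles].
rewrite cell_board_of // eqseq_cons.
by case: eqP => _; [exact: IHw | case: (w')].
Qed.

Lemma uniform_union n t u : uniform n t -> uniform n u -> uniform n (union t u).
Proof.
elim: n t u => [|n IHn] [||b] [||c] //= Hb Hc v lt_v.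
by rewrite cell_bmap2; apply: IHn; [apply: Hb | apply: Hc].
Qed.

Lemma mem_union n t u w : uniform n t -> uniform n u -> tiles w ->
  mem_trie (union t u) w = mem_trie t w || mem_trie u w.
Proof.
elim: w n t u => [|v w IHw] [|n] [||b] [||c] //= Hb Hc; rewrite ?orbF //.
case/andP=> lt_v w_tiles.
by rewrite cell_bmap2 (IHw n) //; [apply: Hb | apply: Hc].
Qed.

Lemma uniform_diff n t u : uniform n t -> uniform n (diff t u).
Proof.
elim: n t u => [|n IHn] [||b] [||c] //= Hb.
have [->|[-> _]] //= := prune_cases (bmap2 diff b c).
by move=> v lt_v; rewrite cell_bmap2; apply: IHn; apply: Hb.
Qed.

Lemma mem_diff t u w :
  tiles w -> mem_trie (diff t u) w = mem_trie t w && ~~ mem_trie u w.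
Proof.
elim: w t u => [|v w IHw] [||b] [||c] //=; rewrite ?andbT //.
  by have [->|[->]] := prune_cases (bmap2 diff b c).
case/andP=> lt_v w_tiles; rewrite -IHw // -cell_bmap2.
have [->|[-> ->]] //= := prune_cases (bmap2 diff b c).
by rewrite cell_board_of //; case: (w).
Qed.

Lemma uniform_relabel l n t : uniform n t -> uniform n (relabel l t).
Proof.
elim: n t => [|n IHn] [||b] //= Hb v lt_v.
by rewrite cell_rot // cell_bmap; apply: IHn; apply: Hb; apply: turn_lt.
Qed.

Lemma mem_relabel l t w :
  tiles w -> mem_trie (relabel l t) w = mem_trie t (map (turn l) w).
Proof.
elim: w t => [|v w IHw] [||b] //= /andP[lt_v w_tiles].
by rewrite cell_rot // cell_bmap IHw.
Qed.

(** * Permutations as words *)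

Local Open Scope group_scope.

Definition line_perm (l : line) : 'S_9 :=
  match l with
  | Col1 => V i1 | Col2 => V i2 | Col3 => V i3
  | Row1 => H i1 | Row2 => H i2 | Row3 => H i3
  end.

Lemma line_permE l (v : 'I_9) : val (line_perm l v) = turn l (val v).
Proof.
by case: l; rewrite permE; case: v => [v lt_v]; move: v lt_v; do 9!case=> //.
Qed.

Lemma line_perm_cube l : line_perm l ^+ 3 = 1.
Proof.
apply/permP => v; apply/val_inj; rewrite !expgS expg0 !permM !perm1 !line_permE.
by case: v => [v lt_v]; case: l; move: v lt_v; do 9!case=> //.
Qed.

Lemma line_permV l : (line_perm l)^-1 = line_perm l ^+ 2.
Proof. by apply/eqP; rewrite eq_invg_mul -expgS line_perm_cube. Qed.

Lemma even_line l : ~~ odd_perm (line_perm l).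
Proof.
have := odd_perm1 'I_9; rewrite -(line_perm_cube l).
rewrite !expgS expg0 mulg1 !odd_permM.
by case: (odd_perm _).
Qed.

Lemma lines_of i :
  (exists l, V i = line_perm l) /\ (exists l, H i = line_perm l).
Proof.
have /or3P[] : [|| i == i1, i == i2 | i == i3] by case: i => [[|[|[|i]]]].
- by move/eqP->; split; [exists Col1 | exists Row1].
- by move/eqP->; split; [exists Col2 | exists Row2].
- by move/eqP->; split; [exists Col3 | exists Row3].
Qed.

Lemma has_linesP (p : pred line) : reflect (exists l, p l) (has p lines).
Proof.
apply: (iffP idP) => [|[]]; last by case=> /= ->; rewrite ?orbT.
rewrite /= orbF; case/orP=> [p1|]; first by exists Col1.
case/orP=> [p2|]; first by exists Col2.
case/orP=> [p3|]; first by exists Col3.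
case/orP=> [p4|]; first by exists Row1.
by case/orP=> [p5|p6]; [exists Row2 | exists Row3].
Qed.

Lemma X3P m :
  reflect (exists l, (m == line_perm l) || (m == line_perm l ^+ 2)) (m \in X3).
Proof.
rewrite inE; apply: (iffP existsP) => [[i /existsP[j /andP[j12 Dm]]]|[l Dm]].
  have [[lc Vi] [lr Hi]] := lines_of i.
  have [l Dl] : exists l, m == line_perm l ^+ j.
    by move: Dm; rewrite Vi Hi => /orP[]; [exists lc | exists lr].
  exists l.
  by case: j j12 Dl {Dm} => [[|[|[|j]]] lt_j] //= _ -> //; rewrite orbT.
have [i Di] : exists i, (line_perm l == V i) || (line_perm l == H i).
  by case: l {Dm}; [exists i1 | exists i2 | exists i3 | exists i1 | exists i2
                   | exists i3]; rewrite eqxx ?orbT.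
exists i; apply/existsP.
have [j j12 Dj] : exists2 j : 'I_3, 1 <= j <= 2 & m == line_perm l ^+ j.
  by case/orP: Dm; [exists i2 | exists i3].
by exists j; rewrite j12 (eqP Dj); case/orP: Di => /eqP->; rewrite eqxx ?orbT.
Qed.

Lemma mem_X3V : {in X3, forall g, g^-1 \in X3}.
Proof.
move=> g /X3P[l Dg]; apply/X3P; exists l.
case/orP: Dg => /eqP->; first by rewrite line_permV eqxx orbT.
by rewrite -line_permV invgK eqxx.
Qed.

Lemma gen_X3 : <<X3>> = G3.
Proof.
have X3_line l : line_perm l \in X3.
  by apply/X3P; exists l; rewrite eqxx.
apply/eqP; rewrite eqEsubset; apply/andP; split; rewrite gen_subG.
  apply/subsetP => m; rewrite inE => /existsP[i /existsP[j /andP[_ Dm]]].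
  apply/mem_gen/bigcupP; exists i => //; rewrite inE.
  by case/orP: Dm => /eqP->; rewrite mem_cycle ?orbT.
apply/bigcupsP => i _; rewrite subUset !cycle_subG.
by have [[lc ->] [lr ->]] := lines_of i; rewrite !mem_gen.
Qed.

(** Seven letters are enough for even permutations, and each of the other two
    would add one node per word to the tries. *)
Definition word (s : 'S_9) : seq nat :=
  [seq val (s i) | i <- take 7 (enum 'I_9)].

Lemma word_tiles s : tiles (word s).
Proof. by apply/allP => _ /mapP[i _ ->]; exact: ltn_ord. Qed.

(** The first factor of a product acts first, so right multiplication acts on
    the letters of a word and not on their places. *)
Lemma word_line s l : map (turn l) (word s) = word (s * line_perm l).
Proof.
by rewrite -map_comp; apply: eq_map => i; rewrite /= permM line_permE.
Qed.

(** A permutation that fixes the first seven points is the identity or the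
    transposition of the last two, which is odd. *)
Lemma word1 (s : 'S_9) : ~~ odd_perm s -> (word s == iota 0 7) = (s == 1).
Proof.
move=> even_s.
have iota7 : iota 0 7 = [seq val i | i <- take 7 (enum 'I_9)].
  by rewrite map_take val_enum_ord.
rewrite iota7; apply/eqP/eqP => [/eq_in_map fix_take|->]; last first.
  by apply: eq_map => i; rewrite /= perm1.
have fix7 (i : 'I_9) : i < 7 -> s i = i.
  move=> lt_i7; apply/val_inj/fix_take.
  by rewrite in_take ?mem_enum // index_enum_ord.
have stab7 (i : 'I_9) : 7 <= i -> 7 <= s i.
  rewrite [7 <= s i]leqNgt; apply: contraL => lt_si.
  by rewrite -ltnNge -(perm_inj (fix7 _ lt_si)).
pose a : 'I_9 := @Ordinal 9 7 isT; pose b : 'I_9 := @Ordinal 9 8 isT.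
have ge7 (i : 'I_9) : 7 <= i -> (i == a) || (i == b).
  by case: i => i lt_i; move: i lt_i; do 9!case=> //.
have split7 (t : 'S_9) :
    t a = s a -> t b = s b -> (forall i : 'I_9, i < 7 -> t i = i) -> s = t.
  move=> ta tb t7; apply/permP => i.
  by have [lt_i7|/ge7/orP[]/eqP->] := ltnP i 7; [rewrite fix7 ?t7 | |].
have [sa|sa] := orP (ge7 _ (stab7 a isT)).
  apply: split7 => [||i _]; rewrite perm1 //; first exact/esym/eqP.
  have /orP[/eqP sb|/eqP //] := ge7 _ (stab7 b isT).
  by have := perm_inj (etrans sb (esym (eqP sa))).
have sb : s b == a.
  have /orP[//|/eqP sb] := ge7 _ (stab7 b isT).
  by have := perm_inj (etrans sb (esym (eqP sa))).
case/negP: even_s; rewrite (split7 (tperm a b)) ?odd_tperm //.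
- by rewrite tpermL (eqP sa).
- by rewrite tpermR (eqP sb).
by move=> i lt_i7; rewrite tpermD //; apply: contraTneq lt_i7 => <-.
Qed.

(** * Breadth-first search *)

(** Membership is only compared on even permutations, where [word] is
    injective. *)
Definition codes (t : trie) (A : {set 'S_9}) : Prop :=
  uniform 7 t /\
  forall s : 'S_9, ~~ odd_perm s -> mem_trie t (word s) = (s \in A).

Lemma codes_single : codes (single (iota 0 7)) 1.
Proof.
split=> [|s even_s]; first exact: (uniform_single (iota 0 7)).
by rewrite mem_single ?word_tiles // word1 // inE.
Qed.

Lemma codes_union t u A B :
  codes t A -> codes u B -> codes (union t u) (A :|: B).
Proof.
move=> [Ut tA] [Uu uB]; split=> [|s even_s]; first exact: uniform_union.
by rewrite (mem_union Ut Uu) ?word_tiles // tA // uB // inE.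
Qed.

Lemma codes_diff t u A B : codes t A -> codes u B -> codes (diff t u) (A :\: B).
Proof.
move=> [Ut tA] [Uu uB]; split=> [|s even_s]; first exact: uniform_diff.
by rewrite mem_diff ?word_tiles // tA // uB // inE andbC.
Qed.

Lemma codes_relabel l t A :
  codes t A -> codes (relabel l t) (A :* (line_perm l)^-1).
Proof.
move=> [Ut tA]; split=> [|s even_s]; first exact: uniform_relabel.
rewrite mem_relabel ?word_tiles // word_line tA ?mem_rcoset ?invgK //.
by rewrite odd_permM (negbTE even_s) (negbTE (even_line l)).
Qed.

(** The inverse of a move is its square, so the products with [X3] are the
    elements that one or two turns of some line bring back into the set. *)
Lemma codes_step t A : codes t A -> codes (step t) (A * X3).
Proof.
move=> tA.
pose back l :=
  A :* (line_perm l)^-1 :|: A :* (line_perm l)^-1 :* (line_perm l)^-1.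
have cube l : line_perm l * (line_perm l * line_perm l) = 1.
  by rewrite -(line_perm_cube l) !expgS expg0 mulg1.
have -> : A * X3 = [set s | has (fun l => s \in back l) lines].
  apply/setP => s; rewrite inE; apply/mulsgP/has_linesP => [[a g Aa]|[l]].
    case/X3P=> l Dg ->; exists l; rewrite inE !mem_rcoset !invgK -!mulgA.
    case/orP: Dg => /eqP->; last by rewrite -expgSr line_perm_cube mulg1 Aa.
    by rewrite cube mulg1 Aa orbT.
  rewrite inE !mem_rcoset !invgK => /orP[] As.
    exists (s * line_perm l) (line_perm l)^-1; rewrite ?mulgK // mem_X3V //.
    by apply/X3P; exists l; rewrite eqxx.
  exists (s * line_perm l * line_perm l) (line_perm l) => //.
    by apply/X3P; exists l; rewrite eqxx.
  by rewrite -!mulgA cube mulg1.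
rewrite /step; elim: lines => [|l ls IHls] /=.
  by split=> // s _; rewrite !inE.
have -> : [set s | (s \in back l) || has (fun l => s \in back l) ls] =
          back l :|: [set s | has (fun l => s \in back l) ls].
  by apply/setP => s; rewrite !inE.
rewrite /back -setUA.
by do ![apply: codes_union | apply: codes_relabel].
Qed.

Lemma codes_layers n :
  codes (layers n).1 (ball X3 n) /\ codes (layers n).2 (sphere X3 n).
Proof.
elim: n => [|n] /=; first by have := codes_single.
case: (layers n) => b f /= [bP fP].
have f'P : codes (diff (step f) b) (sphere X3 n.+1).
  by rewrite sphereS; apply: codes_diff => //; apply: codes_step.
by split=> //; rewrite ball_sphere; apply: codes_union.
Qed.

Lemma even_ball n s : s \in ball X3 n -> ~~ odd_perm s.
Proof.
elim: n s => [|n IHn] s.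
  by rewrite /ball expg0 => /set1P->; rewrite odd_perm1.
rewrite /ball expgSr => /mulsgP[a g /IHn even_a]; rewrite in_setU1 => Xg ->.
rewrite odd_permM (negbTE even_a).
case/predU1P: Xg => [->|]; first by rewrite odd_perm1.
case/X3P=> l /orP[]/eqP->; first exact: even_line.
by rewrite expgS expg1 odd_permM addbb.
Qed.

(** The sphere of radius [n] contains [w], and the next sphere is empty. *)
Definition exhausted (n : nat) (w : seq nat) : bool :=
  let: (b, f) := layers n in
  mem_trie f w && (if diff (step f) b is Empty then true else false).

Lemma diameter_search n (z : 'S_9) :
  ~~ odd_perm z -> exhausted n (word z) -> diameter (cayley G3 X3) = n.
Proof.
move=> even_z stop; apply: (diameter_cayley mem_X3V gen_X3).
  have [_ [_ fP]] := codes_layers n; apply/set0Pn; exists z; rewrite -fP //.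
  by move: stop; rewrite /exhausted; case: (layers n) => b f /= /andP[].
have [bP /codes_step /codes_diff/(_ bP)[_ f'P]] := codes_layers n.
apply/setP => s; rewrite [RHS]inE; apply/negP => Ss.
have even_s : ~~ odd_perm s by case/setDP: (Ss) => /even_ball.
move: (f'P s even_s); rewrite -sphereS Ss.
move: stop; rewrite /exhausted; case: (layers n) => b f /=.
by case/andP=> _; case: diff.
Qed.

Definition half_turn : 'S_9 := perm (@rev_ord_inj 9).

Lemma even_half_turn : ~~ odd_perm half_turn.
Proof.
pose t (k : nat) (lt_k : k < 9) :=
  tperm (Ordinal lt_k) (rev_ord (Ordinal lt_k)).
have -> : half_turn = t 0%N isT * t 1%N isT * t 2%N isT * t 3%N isT.
  apply/permP => i; rewrite !permM permE; apply/val_inj.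
  case: i => i lt_i; move: i lt_i.
  by do 9![case; first by move=> *; rewrite /t !permE].
by rewrite !odd_permM !odd_tperm.
Qed.

Lemma word_half_turn : word half_turn = [:: 8; 7; 6; 5; 4; 3; 2].
Proof.
have -> : word half_turn = [seq 9 - v.+1 | v <- take 7 (iota 0 9)]%N.
  rewrite -val_enum_ord -map_take -map_comp.
  by apply: eq_map => i; rewrite /= permE.
by [].
Qed.

Theorem mainTheorem3 : diameter (cayley G3 X3) = 8.
Proof.
apply: (diameter_search even_half_turn); rewrite word_half_turn.
(* The whole search, run by the kernel. *)
by vm_cast_no_check (erefl true).
Qed.
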